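(* Let $a, b \in \mathbb{R}$ with $a \neq 0$, let $I \subseteq \mathbb{R}$ be a compact interval, and let $X$ be one of the spaces $C(I)$ or $L^p(I)$, $p \in [1,\infty)$. If $f \in C(\mathbb{R})$ has super-exponential decay, then the following statements are equivalent. (1) The system $\mathcal{T}(f,a\mathbb{Z}+b)$ is complete in $X$. (2) There exists $F \in \mathrm{span}(\mathcal{T}(f,a\mathbb{Z}+b))$ such that $\mathcal{T}(F,a\mathbb{Z})$ is complete in $X$. (3) For every $F \in \mathrm{span}(\mathcal{T}(f,a\mathbb{Z}+b)) \setminus \{ 0 \}$ it holds that $\mathcal{T}(F,a\mathbb{Z})$ is complete in $X$.
   Context: All functions are complex-valued and linear spans (finite linear combinations) are over $\mathbb{C}$. $C(\mathbb{R})$ is the space of continuous functions $\mathbb{R}\to\mathbb{C}$, $C(I)$ is the space of continuous functions on $I$ with the supremum norm, and $L^p(I)$ is the usual Lebesgue space (Lebesgue measure) with its usual norm. For $f:\mathbb{R}\to\mathbb{C}$ and $\Lambda\subseteq\mathbb{R}$, the system of $\Lambda$-translates of $f$ is $\mathcal{T}(f,\Lambda)=\{f(\cdot-\lambda):\lambda\in\Lambda\}$, and $\mathrm{span}(\mathcal{T}(f,\Lambda))$ is its linear span as a space of functions on $\mathbb{R}$. The system $\mathcal{T}(f,\Lambda)$ is called complete in $X$ if the restrictions to $I$ of the functions in $\mathrm{span}(\mathcal{T}(f,\Lambda))$ form a dense subset of $X$ with respect to the norm of $X$. Here $a\mathbb{Z}+b=\{ak+b:k\in\mathbb{Z}\}$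 and $a\mathbb{Z}=\{ak:k\in\mathbb{Z}\}$. A function $f:\mathbb{R}\to\mathbb{C}$ has super-exponential decay if for every $\gamma\in\mathbb{R}$ one has $\lim_{|x|\to\infty} f(x)e^{\gamma|x|}=0$.
   Formalization: The implication from (3) to (1) is stated only for f not identically zero, because for f = 0 the span is {0}, so (3) holds vacuously while (1) and (2) fail when I has more than one point. *)

(* Defs.v *)
From HB Require Import structures.
From mathcomp Require Import all_boot all_order all_algebra.
From mathcomp Require Import complex.
From mathcomp Require Import all_classical all_reals all_analysis.

Set Implicit Arguments.
Unset Strict Implicit.
Unset Printing Implicit Defensive.

Import Order.TTheory GRing.Theory Num.Theory.
Import numFieldNormedType.Exports.

Local Open Scope classical_set_scope.
Local Open Scope ring_scope.

(* [R[i]] carries no topology in the library; the regular module [R[i]^o] has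
   the one given by the complex modulus. *)
Notation Cplx R := (R[i]^o)%type.

(* The library norm [`|z|] on [R[i]] takes its values in [R[i]]; this is the
   same modulus with values in [R]. *)
Definition modulus (R : realType) (z : Cplx R) : R := ComplexField.Normc.normc z.

Definition translates (R : realType) (f : R -> Cplx R) (L : set R) :
    set (R -> Cplx R) :=
  [set (fun x => f (x - lam)) | lam in L].

Definition arith_prog (R : realType) (a b : R) : set R :=
  [set a * k%:~R + b | k in [set: int]].

Definition lin_span (R : realType) (S : set (R -> Cplx R)) :
    set (R -> Cplx R) :=
  [set F | exists (n : nat) (c : 'I_n -> Cplx R) (h : 'I_n -> R -> Cplx R),
    (forall i, S (h i)) /\ F = \sum_(i < n) c i *: h i].

Definition super_exp_decay (R : realType) (f : R -> Cplx R) : Prop :=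
  forall gamma : R,
    f x * ((expR (gamma * `|x|))%:C)%C @[x --> +oo] --> (0 : Cplx R) /\
    f x * ((expR (gamma * `|x|))%:C)%C @[x --> -oo] --> (0 : Cplx R).

(* A normed space of functions on a set [I], its elements being represented by
   functions on the whole line. Membership and norm only depend on the
   restriction to [I], so functions that agree on [I] (for [L^p], almost
   everywhere on [I]) represent the same element. *)
Record fun_space (R : realType) := FunSpace {
  in_space : set (R -> Cplx R);
  space_norm : (R -> Cplx R) -> \bar R }.

Definition C_space (R : realType) (I : set R) : fun_space R :=
  FunSpace [set g | {within I, continuous g}]
    (fun g => ereal_sup [set (modulus (g x))%:E | x in I]).

Definition Lp_norm (R : realType) (I : set R) (p : R) (g : R -> Cplx R) :
    \bar R :=
  'N[@lebesgue_measure R]_(p%:E)[(fun x => (modulus (g x))%:E) \_ I]%E.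

(* Measurability is with respect to the Borel sets; every Lebesgue measurable
   class has a Borel representative. *)
Definition Lp_space (R : realType) (I : set R) (p : R) : fun_space R :=
  FunSpace
    [set g | [/\ measurable_fun I (fun x => complex.Re (g x)),
                 measurable_fun I (fun x => complex.Im (g x))
               & (Lp_norm I p g < +oo)%E]]
    (Lp_norm I p).

Definition complete_in (R : realType) (X : fun_space R)
    (S : set (R -> Cplx R)) : Prop :=
  forall g, in_space X g -> forall eps : R, 0 < eps ->
    exists2 h, lin_span S h & (space_norm X (g - h)%R < eps%:E)%E.

(* Main.v *)
Require Import Defs.
From HB Require Import structures.
From mathcomp Require Import all_boot all_order all_algebra.
From mathcomp Require Import complex.
From mathcomp Require Import all_classical all_reals all_analysis.
From mathcomp Require Import measurable_realfun.
From mathcomp Require Import ring lra zify.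

(** Why the theorem holds.  Put [g x = f (x - b)] and let [T] be the translation
    by [a].  The translates of [f] along [aZ + b] are the functions [T^k g], [k]
    in [Z], so taking [F = g] gives (1) implies (2) and, when [f] is nonzero, (3)
    implies (1); and (2) implies (1) since every translate of [F] along [aZ]
    stays in the span of the [T^k g].  The substance is (1) implies (3): if [F]
    is a nonzero combination of the [T^k g], then [g] can be recovered from the
    translates of [F].

    Up to a translation by a multiple of [a], [F = P(T) g] for a nonzero
    polynomial [P] over the complex numbers ([lin_span_lattice]), and [P] splits
    into linear factors.  For one factor, [F = (T - z) g] is solved for [g] by
    the finite geometric expansion
      [g = \sum_(j < N) z^j T^(-j-1) F + z^N T^(-N) g]
    ([geometric_resolution]).  The remainder at [x] is [z^N g(x + N a)]; as [g]
    decays faster than every exponential, it tends to [0] uniformly on compact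
    intervals whatever the size of [z] ([loc_approx_root]).  Peeling off the
    factors one at a time ([loc_approx_poly_translate]) shows that [g] is a
    locally uniform limit of combinations of the [T^k F].

    Locally uniform approximation of continuous functions is enough, because on
    a compact interval the norms of [C(I)] and [L^p(I)] are both controlled by a
    multiple of the supremum norm ([space_norm_perturb]). *)

Set Implicit Arguments.
Unset Strict Implicit.
Unset Printing Implicit Defensive.

Import Order.TTheory GRing.Theory Num.Theory.
Import numFieldNormedType.Exports.

Local Open Scope classical_set_scope.
Local Open Scope ring_scope.

(** * The complex modulus *)

Section Modulus.
Context {R : realType}.
Implicit Types u v : Cplx R.

Lemma norm_modulus u : `|u| = (modulus u)%:C%C.
Proof. by rewrite [LHS]normc_def; case: u. Qed.

Lemma modulus_ge0 u : 0 <= modulus u.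
Proof. by case: u => x y; exact: sqrtr_ge0. Qed.

Lemma modulus0 : modulus (0 : Cplx R) = 0.
Proof. exact: ComplexField.Normc.normc0. Qed.

Lemma modulusD u v : modulus (u + v) <= modulus u + modulus v.
Proof. exact: (@le_normcD R u v). Qed.

Lemma modulusN u : modulus (- u) = modulus u.
Proof. exact: (@normcN R u). Qed.

Lemma modulusM u v : modulus (u * v : Cplx R) = modulus u * modulus v.
Proof. exact: ComplexField.Normc.normcM. Qed.

Lemma modulusX u n : modulus (u ^+ n : Cplx R) = modulus u ^+ n.
Proof.
elim: n => [|n IH]; first exact: ComplexField.Normc.normc1.
by rewrite !exprS modulusM IH.
Qed.

Lemma modulus_real (x : R) : modulus (x%:C%C : Cplx R) = `|x|.
Proof. by rewrite /modulus /= expr0n addr0 sqrtr_sqr. Qed.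

Lemma normRe_le_modulus u : `|complex.Re u| <= modulus u.
Proof.
case: u => x y /=.
by rewrite /modulus /= -sqrtr_sqr ler_wsqrtr// lerDl sqr_ge0.
Qed.

Lemma normIm_le_modulus u : `|complex.Im u| <= modulus u.
Proof.
case: u => x y /=.
by rewrite /modulus /= -[leLHS]sqrtr_sqr ler_wsqrtr// lerDr sqr_ge0.
Qed.

Lemma modulus_ReIm u :
  modulus u = Num.sqrt (complex.Re u ^+ 2 + complex.Im u ^+ 2).
Proof. by case: u. Qed.

(** The topology of [R[i]^o] is given by a norm with values in [R[i]]; a limit
    there can be used with real radii. *)
Lemma cvg_modulus {T} {F : set_system T} {FF : Filter F} (g : T -> Cplx R)
    (l : Cplx R) (e : R) : g @ F --> l -> 0 < e ->
  \forall x \near F, modulus (l - g x) < e.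
Proof.
move=> gl e0.
have eC : 0 < (e%:C)%C :> R[i] by rewrite ltcR.
move/cvgrPdist_lt : gl => /(_ _ eC).
by apply: filterS => x; rewrite norm_modulus ltcR.
Qed.

Lemma Re_continuous (h : R -> Cplx R) :
  continuous h -> continuous (fun x => complex.Re (h x) : R).
Proof.
move=> ch x; apply/cvgrPdist_lt => e e0.
apply: filterS (cvg_modulus (ch x) e0) => y; apply: le_lt_trans.
by rewrite -[X in X <= _]/(`|_ - _|) -raddfB; exact: normRe_le_modulus.
Qed.

Lemma Im_continuous (h : R -> Cplx R) :
  continuous h -> continuous (fun x => complex.Im (h x) : R).
Proof.
move=> ch x; apply/cvgrPdist_lt => e e0.
apply: filterS (cvg_modulus (ch x) e0) => y; apply: le_lt_trans.
by rewrite -[X in X <= _]/(`|_ - _|) -raddfB; exact: normIm_le_modulus.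
Qed.
End Modulus.

(** * Linear spans *)

Section Span.
Context {R : realType}.
Implicit Types (S T : set (R -> Cplx R)) (g h : R -> Cplx R).

Lemma lin_span_gen S h : S h -> lin_span S h.
Proof.
move=> Sh; exists 1%N, (fun=> 1), (fun=> h); split=> //.
by rewrite big_ord1 scale1r.
Qed.

Lemma lin_span0 S : lin_span S 0.
Proof.
by exists 0%N, (fun=> 0), (fun=> 0); split=> [[]//|]; rewrite big_ord0.
Qed.

Lemma lin_spanZ S (k : Cplx R) h : lin_span S h -> lin_span S (k *: h).
Proof.
move=> [n [c [H [SH ->]]]]; exists n, (fun i => k * c i), H; split=> //.
by rewrite scaler_sumr; apply: eq_bigr => i _; rewrite scalerA.
Qed.

Lemma lin_spanD S g h : lin_span S g -> lin_span S h -> lin_span S (g + h).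
Proof.
move=> [n [c [G [SG ->]]]] [m [e [H [SH ->]]]].
exists (n + m)%N, (fun i : 'I_(n + m) =>
  match fintype.split i with inl j => c j | inr j => e j end).
exists (fun i : 'I_(n + m) =>
  match fintype.split i with inl j => G j | inr j => H j end).
split=> [i|]; first by case: (fintype.split i).
rewrite big_split_ord /=; congr (_ + _); apply: eq_bigr => i _.
  by rewrite (unsplitK (inl i)).
by rewrite (unsplitK (inr i)).
Qed.

Lemma lin_span_sum S n (h : 'I_n -> R -> Cplx R) :
  (forall i, lin_span S (h i)) -> lin_span S (\sum_(i < n) h i).
Proof.
by move=> Sh; elim/big_ind : _ => //; [exact: lin_span0 | exact: lin_spanD].
Qed.

Lemma lin_span_sub S T : S `<=` lin_span T -> lin_span S `<=` lin_span T.
Proof.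
move=> ST _ [n [c [h [Sh ->]]]]; apply: lin_span_sum => i.
by apply: lin_spanZ; exact: ST.
Qed.

Lemma lin_span_continuous S : S `<=` [set h | continuous h] ->
  lin_span S `<=` [set h | continuous h].
Proof.
move=> cS _ [n [c [h [Sh ->]]]] /=; elim/big_ind : _ => [x|g1 g2 c1 c2 x|i _ x].
- exact: cvg_cst.
- by apply: (@cvgD _ (R[i]^o) _ _ _ g1 g2); [exact: c1 | exact: c2].
- apply: (@cvgZl_tmp _ (R[i]^o) _ _ _ (c i) (h i)); exact: cS.
Qed.

End Span.

(** * Super-exponential decay *)

Section Decay.
Context {R : realType}.
Implicit Types (g : R -> Cplx R) (z : Cplx R).

(** Super-exponential decay in a form that is visibly stable under translation
    and linear combination.  Rates are nonnegative so that
    [expR (gamma * `|x|)] increases with [`|x|]. *)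
Definition decays g := forall gamma eps : R, 0 <= gamma -> 0 < eps ->
  exists M, forall x, M <= `|x| -> modulus (g x) * expR (gamma * `|x|) <= eps.

Lemma super_exp_decay_decays g : super_exp_decay g -> decays g.
Proof.
move=> gdecay gamma eps _ eps0; have [gp gn] := gdecay gamma.
have near_le F (FF : Filter F) :
    g x * ((expR (gamma * `|x|))%:C)%C @[x --> F] --> (0 : Cplx R) ->
    \forall x \near F, modulus (g x) * expR (gamma * `|x|) <= eps.
  move=> /cvg_modulus/(_ eps0); apply: filterS => x.
  rewrite sub0r modulusN modulusM modulus_real ger0_norm ?expR_ge0//.
  exact: ltW.
have [Mp [_ Mp_le]] := near_le _ _ gp; have [Mn [_ Mn_le]] := near_le _ _ gn.
exists (`|Mp| + `|Mn| + 1) => x Mx.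
have := ler_norm Mp; have := lerNnormlW (lexx `|Mn|).
have := normr_ge0 Mp; have := normr_ge0 Mn => *.
have [x0|x0] := leP 0 x.
  by rewrite (ger0_norm x0) in Mx; apply: Mp_le; lra.
by rewrite (ltr0_norm x0) in Mx; apply: Mn_le; lra.
Qed.

Lemma decays_translate g s : decays g -> decays (fun x => g (x - s)).
Proof.
move=> gdecay gamma eps gamma0 eps0.
have E0 := expR_gt0 (gamma * `|s|).
have [M Mle] := gdecay gamma _ gamma0 (divr_gt0 eps0 E0).
exists (M + `|s|) => x Mx.
have /Mle : M <= `|x - s| by have := lerB_dist x s; lra.
rewrite ler_pdivlMr// -mulrA -expRD -mulrDr; apply: le_trans.
rewrite ler_wpM2l ?modulus_ge0// ler_expR ler_wpM2l//.
by rewrite -[leLHS](congr1 Num.norm (subrK s x)) ler_normD.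
Qed.

Lemma decaysB_scale g1 g2 z :
  decays g1 -> decays g2 -> decays (fun x => g1 x - z * g2 x).
Proof.
move=> g1decay g2decay gamma eps gamma0 eps0.
have z1 : 0 < modulus z + 1 by rewrite ltr_wpDl// modulus_ge0.
have eps20 : 0 < eps / 2 by rewrite divr_gt0.
have [M1 M1le] := g1decay gamma _ gamma0 eps20.
have [M2 M2le] := g2decay gamma _ gamma0 (divr_gt0 eps20 z1).
exists (`|M1| + `|M2|) => x Mx.
have := normr_ge0 M1; have := normr_ge0 M2.
have := ler_norm M1; have := ler_norm M2 => h1 h2 h3 h4.
have /M1le b1 : M1 <= `|x| by lra.
have /M2le : M2 <= `|x| by lra.
rewrite ler_pdivlMr// => b2.
have := modulusD (g1 x) (- (z * g2 x)); rewrite modulusN modulusM => b3.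
have := expR_ge0 (gamma * `|x|).
have := modulus_ge0 z; have := modulus_ge0 (g2 x).
move: b1 b2 b3; move: (expR _) (modulus _) (modulus _) (modulus _) (modulus _).
move=> E m1 m2 m3 m4 *; nra.
Qed.

End Decay.

(** * Locally uniform approximation by translates *)

Section Approximation.
Context {R : realType} (a : R).
Implicit Types (F g h : R -> Cplx R) (z : Cplx R).

(** [h] is a locally uniform limit of combinations of the translates of [F]
    along [aZ].  Quantifying over all compact intervals, instead of fixing one,
    makes the relation invariant under translation of [h], hence transitive. *)
Definition loc_approx F h := forall c d eps : R, 0 < eps ->
  exists2 g, lin_span (translates F (arith_prog a 0)) g &
    forall x, x \in `[c, d] -> modulus (h x - g x) <= eps.

Lemma lin_span_translate F (k : int) :
  lin_span (translates F (arith_prog a 0)) (fun x => F (x - a * k%:~R)).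
Proof.
by apply: lin_span_gen; exists (a * k%:~R) => //; exists k; rewrite ?addr0.
Qed.

Lemma translate_lin_span F g (k : int) :
  lin_span (translates F (arith_prog a 0)) g ->
  lin_span (translates F (arith_prog a 0)) (fun x => g (x - a * k%:~R)).
Proof.
move=> [n [c [h [Sh ->]]]].
exists n, c, (fun i x => h i (x - a * k%:~R)); split=> [i|].
  have [_ [j _ <-] <-] := Sh i.
  exists (a * (k + j)%:~R + 0); first by exists (k + j).
  by apply/funext => x; congr F; rewrite intrD; ring.
by apply/funext => x; rewrite !fct_sumE.
Qed.

Lemma lin_span_loc_approx F h :
  lin_span (translates F (arith_prog a 0)) h -> loc_approx F h.
Proof.
move=> Fh c d eps eps0; exists h => // x _.
by rewrite subrr modulus0 ltW.
Qed.

Lemma loc_approx_translate F h (k : int) :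
  loc_approx F h -> loc_approx F (fun x => h (x - a * k%:~R)).
Proof.
move=> Fh c d eps eps0.
have [g Fg gh] := Fh (c - a * k%:~R) (d - a * k%:~R) eps eps0.
exists (fun x => g (x - a * k%:~R)); first exact: translate_lin_span.
by move=> x; rewrite in_itv /= => xcd; apply: gh; rewrite in_itv /= !lerD2r.
Qed.

Lemma loc_approxD F h1 h2 :
  loc_approx F h1 -> loc_approx F h2 -> loc_approx F (h1 + h2).
Proof.
move=> F1 F2 c d eps eps0; have eps20 : 0 < eps / 2 by lra.
have [g1 Fg1 gh1] := F1 c d _ eps20; have [g2 Fg2 gh2] := F2 c d _ eps20.
exists (g1 + g2); first exact: lin_spanD.
move=> x xcd; rewrite -[(_ + _) x]/(h1 x + h2 x) -[(_ + _) x]/(g1 x + g2 x).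
rewrite opprD addrACA (le_trans (modulusD _ _))//.
by have := gh1 x xcd; have := gh2 x xcd; lra.
Qed.

Lemma loc_approxZ F h z : loc_approx F h -> loc_approx F (z *: h).
Proof.
move=> Fh c d eps eps0.
have z1 : 0 < modulus z + 1 by rewrite ltr_wpDl// modulus_ge0.
have [g Fg gh] := Fh c d _ (divr_gt0 eps0 z1).
exists (z *: g); first exact: lin_spanZ.
move=> x /gh; rewrite ler_pdivlMr//; apply: le_trans.
rewrite -[(_ *: _) x - _]/(z * h x - z * g x) -mulrBr modulusM.
by have := modulus_ge0 (h x - g x); nra.
Qed.

Lemma loc_approx_lin_span F S :
  S `<=` loc_approx F -> lin_span S `<=` loc_approx F.
Proof.
move=> SF _ [n [c [h [Sh ->]]]]; elim/big_ind : _ => [|h1 h2|i _].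
- by apply: lin_span_loc_approx; exact: lin_span0.
- exact: loc_approxD.
- by apply: loc_approxZ; exact: SF.
Qed.

(** The combination of translates of [g] close to [h] is itself in the closure
    of the combinations of translates of [F], by translation invariance. *)
Lemma loc_approx_trans F g h :
  loc_approx F g -> loc_approx g h -> loc_approx F h.
Proof.
move=> Fg gh c d eps eps0; have eps20 : 0 < eps / 2 by lra.
have [g1 gg1 hg1] := gh c d _ eps20.
have /(_ c d _ eps20)[g2 Fg2 g12] : loc_approx F g1.
  apply: loc_approx_lin_span gg1 => _ [_ [k _ <-] <-].
  by rewrite addr0; exact: loc_approx_translate.
exists g2 => // x xcd; rewrite -(subrKA (g1 x)) (le_trans (modulusD _ _))//.
by have := hg1 x xcd; have := g12 x xcd; lra.
Qed.

(** The expansion [1 - (z T^-1)^N = (T - z) \sum_(j < N) z^j T^(-j-1)], with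
    [T] the translation by [a], applied to [g]. *)
Lemma geometric_resolution g z N x :
  g x - \sum_(j < N) z ^+ j *
    (g (x + a * j.+1%:R - a) - z * g (x + a * j.+1%:R)) =
  z ^+ N * g (x + a * N%:R).
Proof.
elim: N => [|N IH]; first by rewrite big_ord0 subr0 expr0 mul1r mulr0 addr0.
rewrite big_ord_recr /= opprD addrA IH.
have -> : x + a * N.+1%:R - a = x + a * N%:R by rewrite -natr1; ring.
by rewrite exprS; move: (g _) (g _) => u v; ring.
Qed.

(** The translates of [(T - z) g] recover [g]: the remainder of the geometric
    expansion is [z^N g(x + a N)], and [|z|^N] is at most
    [exp (gamma |a| N)] with [gamma = |z| / |a|].  This is an exponential in the
    size of the argument [x + a N], which the decay of [g] absorbs. *)
Lemma loc_approx_root g z :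
  a != 0 -> decays g -> loc_approx (fun x => g (x - a) - z * g x) g.
Proof.
move=> a_neq0 gdecay c d eps eps0.
set F := fun x => g (x - a) - z * g x.
have a0 : 0 < `|a| by rewrite normr_gt0.
(* [B] bounds [`|x|] on the interval, so that [`|x + a * N|] differs from
   [N * `|a|] by at most [B]. *)
pose gamma := modulus z / `|a|; pose B := `|c| + `|d|.
have gamma0 : 0 <= gamma by rewrite divr_ge0 ?modulus_ge0.
have E0 := expR_gt0 (gamma * B).
have [M Mle] := gdecay gamma _ gamma0 (divr_gt0 eps0 E0).
pose N := Num.bound (`|M + B| / `|a|).
have Nlarge : M + B <= N%:R * `|a|.
  rewrite (le_trans (ler_norm _))// -ler_pdivrMr//.
  by rewrite ltW// archi_boundP// divr_ge0.
pose G : R -> Cplx R :=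
  \sum_(j < N) z ^+ j *: (fun x => F (x - a * (- j.+1%:Z)%:~R)).
exists G.
  by apply: lin_span_sum => j; apply: lin_spanZ; exact: lin_span_translate.
move=> x; rewrite in_itv /= => /andP[cx xd].
have xB : `|x| <= B.
  rewrite ler_norml /B; have := ler_norm d; have := lerNnormlW (lexx `|c|).
  have := normr_ge0 c; have := normr_ge0 d => *.
  by apply/andP; split; lra.
have -> : g x - G x = z ^+ N * g (x + a * N%:R).
  rewrite -geometric_resolution /G fct_sumE; congr (_ - _).
  apply: eq_bigr => j _.
  have E : x - a * (- j.+1%:Z)%:~R = x + a * j.+1%:R.
    by rewrite rmorphN mulrN opprK.
  by rewrite -[LHS]/(z ^+ j * F _) E.
set y := x + a * N%:R.
have Ny : N%:R * `|a| - B <= `|y|.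
  have := lerB_normD (a * N%:R) x.
  rewrite normrM normr_nat [_ + x]addrC -/y; lra.
have Ny' : N%:R * `|a| <= B + `|y| by lra.
have /Mle : M <= `|y| by lra.
rewrite ler_pdivlMr// -mulrA -expRD -mulrDr modulusM modulusX [_ ^+ N * _]mulrC.
apply: le_trans; rewrite ler_wpM2l ?modulus_ge0//.
apply: (@le_trans _ _ (expR (modulus z) ^+ N)).
  by rewrite lerXn2r ?nnegrE ?modulus_ge0 ?expR_ge0//;
    have := expR_ge1Dx (modulus z); lra.
rewrite -expRM_natl ler_expR.
have -> : N%:R * modulus z = gamma * (N%:R * `|a|).
  by rewrite /gamma; field; rewrite gt_eqF.
by rewrite ler_wpM2l// addrC.
Qed.

End Approximation.

(** * Polynomials in the translation *)

Section PolyTranslate.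
Context {R : realType} (a : R).
Implicit Types (g : R -> Cplx R).

(** The function [P(T) g], where [T] is the translation by [a]. *)
Definition poly_translate (P : {poly R[i]}) g : R -> Cplx R :=
  fun x => \sum_(j < size P) P`_j * g (x - a * j%:R).

Lemma poly_translate_widen (P : {poly R[i]}) g N x : (size P <= N)%N ->
  poly_translate P g x = \sum_(j < N) P`_j * g (x - a * j%:R).
Proof.
move=> PN; rewrite /poly_translate.
rewrite (big_ord_widen N (fun j => P`_j * g (x - a * j%:R)))//=.
rewrite [LHS]big_mkcond; apply: eq_bigr => j _.
by case: ltnP => // Pj; rewrite nth_default// mul0r.
Qed.

Lemma poly_translateC (k : R[i]) g : poly_translate k%:P g = k *: g.
Proof.
apply/funext => x; rewrite (@poly_translate_widen _ _ 1) ?size_polyC_leq1//.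
by rewrite big_ord1 coefC mulr0 subr0.
Qed.

(** The factor [T - z] is moved onto the function rather than onto the result,
    so that an induction on the factors only has to carry decay through
    [g |-> (T - z) g]. *)
Lemma poly_translateM_XsubC (Q : {poly R[i]}) (z : R[i]) g :
  poly_translate (Q * ('X - z%:P)) g =
  poly_translate Q (fun x => g (x - a) - z * g x).
Proof.
apply/funext => x.
rewrite (@poly_translate_widen _ _ (size Q).+1); last first.
  by rewrite (leq_trans (size_polyMleq _ _))// size_XsubC addn2.
have -> : \sum_(j < (size Q).+1) (Q * ('X - z%:P))`_j * g (x - a * j%:R) =
    \sum_(j < (size Q).+1) (Q * 'X)`_j * g (x - a * j%:R) -
    \sum_(j < (size Q).+1) Q`_j * (z * g (x - a * j%:R)).
  rewrite -sumrB; apply: eq_bigr => j _.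
  by rewrite mulrBr coefB coefMC mulrBl mulrA.
rewrite big_ord_recl coefMX eqxx mul0r add0r big_ord_recr /=.
rewrite [Q`_(size Q)]nth_default// mul0r addr0 -sumrB.
apply: eq_bigr => j _; rewrite coefMX /= mulrBr; congr (_ * g _ - _).
by rewrite /bump /= add1n -natr1; ring.
Qed.

(** [P] splits into linear factors, and the translates of [(T - z) g] recover
    [g]; the nonzero leading coefficient accounts for the constant case. *)
Lemma loc_approx_poly_translate (P : {poly R[i]}) g :
  a != 0 -> P != 0 -> decays g -> loc_approx a (poly_translate P g) g.
Proof.
move=> a_neq0; rewrite -lead_coef_eq0.
have [r {2}->] := closed_field_poly_normal P.
move: (lead_coef P) => l l0; elim: r g => [|z r IH] g gdecay.
  rewrite big_nil alg_polyC poly_translateC.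
  rewrite -[X in loc_approx _ _ X]scale1r -(mulVf l0) -scalerA.
  apply: loc_approxZ; apply: lin_span_loc_approx.
  by have := lin_span_translate a (l *: g) 0;
    under eq_fun do rewrite mulr0 subr0.
rewrite big_cons mulrC scalerAl poly_translateM_XsubC.
apply: loc_approx_trans (loc_approx_root z a_neq0 gdecay); apply: IH.
by apply: decaysB_scale => //; exact: decays_translate.
Qed.

End PolyTranslate.

Section Lattice.
Context {R : realType}.
Implicit Types (f F : R -> Cplx R).

(** Replacing [f] by [f (x - b)] reduces the progression [aZ + b] to [aZ]. *)
Lemma translates_arith_prog f (a b : R) :
  translates f (arith_prog a b) =
  translates (fun x => f (x - b)) (arith_prog a 0).
Proof.
apply/seteqP; split=> _ [_ [k _ <-] <-].
  exists (a * k%:~R + 0); first by exists k.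
  by apply/funext => x; congr f; ring.
exists (a * k%:~R + b); first by exists k.
by apply/funext => x; congr f; ring.
Qed.

(** A combination of translates along [aZ] is a Laurent polynomial in the
    translation; a translation by [a * m] clears the negative exponents. *)
Lemma lin_span_lattice F f (a : R) :
  lin_span (translates f (arith_prog a 0)) F ->
  exists2 P : {poly R[i]}, P = 0 -> F = 0 &
  exists m : nat, (fun x => F (x - a * m%:R)) = poly_translate a P f.
Proof.
move=> [n [c [h [fh ->]]]].
have [k hk] : exists k : 'I_n -> int,
    forall i, h i = fun x => f (x - a * (k i)%:~R).
  have /choice[k hk] : forall i, exists k : int,
      h i = fun x => f (x - a * k%:~R).
    by move=> i; have [_ [k _ <-] <-] := fh i; exists k; rewrite addr0.
  by exists k.
(* a bound for all exponents in absolute value *)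
pose m := (\sum_(i < n) `|k i|)%N.
pose q i := `|(k i + m%:Z)%R|%N.
have qE i : (q i)%:Z = k i + m%:Z.
  rewrite gez0_abs// /m (bigD1 i)//= PoszD addrA.
  by rewrite addr_ge0// -lerBlDr sub0r; lia.
pose P : {poly R[i]} := \sum_(i < n) c i *: 'X^(q i).
have PE : (fun x => (\sum_(i < n) c i *: h i) (x - a * m%:R)) =
    poly_translate a P f.
  apply/funext => x; pose N := maxn (size P) (\max_(i < n) (q i).+1).
  rewrite (@poly_translate_widen _ _ _ _ N) ?leq_maxl// fct_sumE.
  under [RHS]eq_bigr do rewrite coef_sum mulr_suml.
  rewrite exchange_big /=; apply: eq_bigr => i _.
  have qN : (q i < N)%N.
    by rewrite leq_max (leq_bigmax (F := fun i => (q i).+1)) orbT.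
  rewrite (bigD1 (Ordinal qN))//= big1 ?addr0 => [|j jq]; last first.
    by rewrite coefZ coefXn -[_ == _]/(j == Ordinal qN) (negbTE jq) mulr0 mul0r.
  rewrite coefZ coefXn eqxx mulr1 hk.
  rewrite -[LHS]/(c i * f _); congr (_ * f _).
  have -> : (q i)%:R = (k i)%:~R + m%:R :> R.
    by rewrite -[LHS]/((q i)%:Z%:~R) qE rmorphD.
  by ring.
exists P; last by exists m.
move=> P0; apply/funext => x; move/(congr1 (@^~ (x + a * m%:R))) : PE => /=.
rewrite addrK => ->; rewrite P0 /poly_translate size_poly0.
by rewrite big_ord0.
Qed.

End Lattice.

(** * Comparison of the norms with the supremum norm *)

Section Norms.
Context {R : realType}.
Implicit Types (g h : R -> Cplx R).

Local Notation mu := (@lebesgue_measure R).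

Lemma le_Lnorm (p : R) (u v : R -> R) : 0 <= p ->
  measurable_fun setT u -> measurable_fun setT v ->
  (forall x, 0 <= u x) -> (forall x, u x <= v x) ->
  ('N[mu]_p%:E[EFin \o u] <= 'N[mu]_p%:E[EFin \o v])%E.
Proof.
move=> p0 meas_u mv u0 uv; rewrite unlock.
have mpow (w : R -> R) : measurable_fun setT w ->
    measurable_fun setT (fun x => `|(EFin \o w) x| `^ p)%E.
  move=> mw; apply: (measurableT_comp (measurable_poweR p)).
  by apply: measurableT_comp => //; exact: measurableT_comp.
apply: gt0_ler_poweR; rewrite ?invr_ge0 ?in_itv/= ?leey ?andbT//.
- by apply: integral_ge0 => x _; rewrite lee_fin powR_ge0.
- by apply: integral_ge0 => x _; rewrite lee_fin powR_ge0.
- apply: ge0_le_integral => //.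
  + exact: (mpow u).
  + exact: (mpow v).
  + move=> x _; rewrite lee_fin.
    have v0 : 0 <= v x := le_trans (u0 x) (uv x).
    by rewrite !ger0_norm// ge0_ler_powR// nnegrE.
Qed.

Lemma Lnorm_cst_itv (c d p e : R) : c <= d -> 1 <= p -> 0 <= e ->
  'N[mu]_p%:E[EFin \o (cst e \_ `[c, d])]%E = (e * (d - c) `^ p^-1)%:E.
Proof.
move=> cd p1 e0; have p0 : p != 0 by rewrite gt_eqF// (lt_le_trans ltr01).
have mu_itv : mu `[c, d] = (d - c)%:E.
  rewrite lebesgue_measure_itv /= lte_fin.
  by case: ltgtP cd => // -> _; rewrite subrr.
rewrite unlock.
have -> : (\int[mu]_x `|(EFin \o (cst e \_ `[c, d])) x| `^ p =
    (e `^ p * (d - c))%:E)%E.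
  transitivity (\int[mu]_(x in `[c, d]) cst (e `^ p)%:E x)%E.
    rewrite [RHS]integral_mkcond; apply: eq_integral => x _.
    rewrite /= /patch; case: ifP => _; first by rewrite ger0_norm.
    by rewrite normr0 powR0.
  by rewrite integral_cst// [X in (_ * X)%E]mu_itv -EFinM.
by rewrite poweR_EFin powRM ?powR_ge0 ?subr_ge0// -powRrM divff// powRr1.
Qed.

Lemma measurable_modulusB (D : set R) g h : measurable D ->
  measurable_fun D (fun x => complex.Re (g x)) ->
  measurable_fun D (fun x => complex.Im (g x)) ->
  continuous h -> measurable_fun D (fun x => modulus (g x - h x)).
Proof.
move=> mD mRe mIm ch.
have mReh : measurable_fun D (fun x => complex.Re (h x)).
  by apply: measurable_funTS; apply: continuous_measurable_fun;
    exact: Re_continuous.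
have mImh : measurable_fun D (fun x => complex.Im (h x)).
  by apply: measurable_funTS; apply: continuous_measurable_fun;
    exact: Im_continuous.
have -> : (fun x => modulus (g x - h x)) = @Num.sqrt R \o
    ((fun x => (complex.Re (g x) - complex.Re (h x)) ^+ 2) \+
     (fun x => (complex.Im (g x) - complex.Im (h x)) ^+ 2)).
  by apply/funext => x; rewrite modulus_ReIm /= !raddfB.
apply: measurableT_comp.
  by apply: continuous_measurable_fun; exact: sqrt_continuous.
by apply: measurable_funD; apply: measurable_funX; exact: measurable_funB.
Qed.

Lemma C_norm_perturb (I : set R) g h h' (e : R) :
  (forall x, I x -> modulus (h x - h' x) <= e) ->
  (space_norm (C_space I) (g - h')%R
     <= space_norm (C_space I) (g - h)%R + e%:E)%E.
Proof.
move=> hh'; apply: ge_ereal_sup => _ [x Ix <-].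
have le_sup :
    ((modulus ((g - h)%R x))%:E <= space_norm (C_space I) (g - h)%R)%E.
  by apply: ereal_sup_ubound; exists x.
apply: le_trans (leeD le_sup (lexx _)); rewrite -EFinD lee_fin.
rewrite -[(g - h') x]/(g x - h' x) -(subrKA (h x)).
by rewrite (le_trans (modulusD _ _))// lerD2l hh'.
Qed.

(** Minkowski's inequality applied to the real functions [`|g - h|] and the
    constant [e] on the interval, whose sum dominates [`|g - h'|]. *)
Lemma Lp_norm_perturb (c d p : R) g h h' (e : R) : c <= d -> 1 <= p -> 0 <= e ->
  in_space (Lp_space `[c, d] p) g -> continuous h -> continuous h' ->
  (forall x, x \in `[c, d] -> modulus (h x - h' x) <= e) ->
  (Lp_norm `[c, d] p (g - h')%R
     <= Lp_norm `[c, d] p (g - h)%R + (e * (d - c) `^ p^-1)%R%:E)%E.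
Proof.
move=> cd p1 e0 [mRe mIm _] ch ch' hh'.
set I := `[c, d]%classic in mRe mIm *.
have mI : measurable I by exact: measurable_itv.
pose u k := (fun x => modulus (g x - k x)) \_ I.
have LpE k : Lp_norm I p (g - k) = 'N[mu]_p%:E[EFin \o u k]%E.
  by rewrite /u -restrict_EFin.
have meas_u k : continuous k -> measurable_fun setT (u k).
  by move=> ck; apply/(measurable_restrictT _ mI); exact: measurable_modulusB.
have mcst : measurable_fun setT (cst e \_ I).
  exact/(measurable_restrictT _ mI).
rewrite !LpE -Lnorm_cst_itv//.
apply: (le_trans _ (minkowski_EFin mu (meas_u _ ch) mcst p1)).
apply: le_Lnorm; [lra | exact: meas_u | | |].
- by apply: measurable_funD => //; exact: meas_u.
- by move=> x; rewrite /u /patch; case: ifP => // _; exact: modulus_ge0.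
- move=> x; rewrite /u /= /patch; case: ifPn => [|_]; last by rewrite addr0.
  rewrite inE => Ix; rewrite -(subrKA (h x)).
  rewrite (le_trans (modulusD _ _))// lerD2l; exact: hh'.
Qed.

(** All that the argument uses about the two families of spaces: changing the
    approximant by at most [e] uniformly on the interval costs at most a fixed
    multiple of [e] in norm. *)
Lemma space_norm_perturb (c d : R) (X : fun_space R) : c <= d ->
  X = C_space `[c, d] \/ (exists2 p : R, 1 <= p & X = Lp_space `[c, d] p) ->
  exists2 C : R, 0 <= C & forall g h h' e, 0 <= e -> in_space X g ->
    continuous h -> continuous h' ->
    (forall x, x \in `[c, d] -> modulus (h x - h' x) <= e) ->
    (space_norm X (g - h')%R <= space_norm X (g - h)%R + (e * C)%R%:E)%E.
Proof.
move=> cd [->|[p p1 ->]].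
  exists 1 => // g h h' e e0 _ _ _ hh'.
  by rewrite mulr1; exact: C_norm_perturb.
exists ((d - c) `^ p^-1); first exact: powR_ge0.
by move=> g h h' e e0 Xg ch ch' hh'; exact: Lp_norm_perturb.
Qed.

End Norms.

(** * Completeness and approximation *)

Section Completeness.
Context {R : realType}.

Lemma continuous_translate (g : R -> Cplx R) s :
  continuous g -> continuous (fun x => g (x - s)).
Proof.
move=> cg x; apply: (@continuous_comp _ _ _ (fun y => y - s) g); last exact: cg.
by apply: cvgB; [exact: cvg_id | exact: cvg_cst].
Qed.

Lemma complete_in_sub (X : fun_space R) (S T : set (R -> Cplx R)) :
  S `<=` lin_span T -> complete_in X S -> complete_in X T.
Proof.
move=> ST XS g Xg eps eps0; have [h Sh hg] := XS g Xg eps eps0.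
by exists h => //; exact: lin_span_sub Sh.
Qed.

(** A dense span may be replaced by the translates of [F] as soon as these
    approximate its generators locally uniformly. *)
Lemma complete_in_approx (a c d : R) (X : fun_space R) (F : R -> Cplx R)
    (S : set (R -> Cplx R)) : c <= d ->
  X = C_space `[c, d] \/ (exists2 p : R, 1 <= p & X = Lp_space `[c, d] p) ->
  continuous F -> S `<=` [set h | continuous h] -> S `<=` loc_approx a F ->
  complete_in X S -> complete_in X (translates F (arith_prog a 0)).
Proof.
move=> cd /(space_norm_perturb cd)[C C0 XC] cF cS SF XS g Xg eps eps0.
have eps20 : 0 < eps / 2 by rewrite divr_gt0.
have [h Sh hg] := XS g Xg _ eps20.
have C1 : 0 < C + 1 by rewrite ltr_wpDl.
have [h' Fh' hh'] := loc_approx_lin_span SF Sh c d (divr_gt0 eps20 C1).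
have ch' : continuous h'.
  apply: lin_span_continuous Fh' => _ [s _ <-]; exact: continuous_translate.
exists h' => //; apply: le_lt_trans (XC g h h' _ _ Xg _ ch' _) _.
- exact: ltW (divr_gt0 eps20 C1).
- exact: lin_span_continuous Sh.
- by move=> x; exact: hh'.
- rewrite [eps in (_ < eps%:E)%E]splitr EFinD lte_leD// lee_fin.
  by rewrite mulrAC ler_pdivrMr// ler_wpM2l ?lerDl// ltW.
Qed.

End Completeness.

(** * The equivalence *)

Theorem theorem1p2 (R : realType) (a b : R) (ha : a != 0)
    (c d : R) (hcd : c <= d) (X : fun_space R)
    (hX : X = C_space `[c, d] \/
          exists2 p : R, 1 <= p & X = Lp_space `[c, d] p)
    (f : R -> Cplx R) (hf : continuous f) (hdecay : super_exp_decay f) :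
  let S := lin_span (translates f (arith_prog a b)) in
  let complete_translates (g : R -> Cplx R) (L : set R) :=
    complete_in X (translates g L) in
  let stmt1 := complete_translates f (arith_prog a b) in
  let stmt2 := exists2 F, S F & complete_translates F (arith_prog a 0) in
  let stmt3 := forall F, (S `\ 0) F ->
    complete_translates F (arith_prog a 0) in
  [/\ stmt1 <-> stmt2, stmt1 -> stmt3 & f <> 0 -> stmt3 -> stmt1].
Proof.
cbv beta zeta; rewrite translates_arith_prog; set g := fun x => f (x - b).
have cg : continuous g by exact: continuous_translate.
have gdecay : decays g.
  by apply: decays_translate; exact: super_exp_decay_decays.
have Sg : lin_span (translates g (arith_prog a 0)) g.
  by have := lin_span_translate a g 0; under eq_fun do rewrite mulr0 subr0.
split.
- split=> [Xg|[F SF XF]]; first by exists g.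
  apply: complete_in_sub XF => _ [_ [k _ <-] <-].
  by rewrite addr0; exact: translate_lin_span.
(* (1) implies (3): the translates of [F] recover [g]. *)
- move=> Xg F [SF F0].
  have cS : translates g (arith_prog a 0) `<=` [set h | continuous h].
    by move=> _ [s _ <-]; exact: (continuous_translate cg).
  apply: (complete_in_approx hcd hX _ cS _ Xg).
    exact: lin_span_continuous SF.
  have [P P0 [m FP]] := lin_span_lattice SF.
  have Fg : loc_approx a F g.
    apply: (@loc_approx_trans _ _ _ (poly_translate a P g)).
      rewrite -FP; exact: lin_span_loc_approx (lin_span_translate a F m).
    by apply: loc_approx_poly_translate => //; apply/eqP => /P0.
  move=> _ [_ [k _ <-] <-].
  by rewrite addr0; exact: loc_approx_translate.
- move=> f0 XF; apply: XF; split=> // g0; apply: f0.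
  apply/funext => x; have := congr1 (@^~ (x + b)) g0.
  by rewrite /g /= addrK.
Qed.
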